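(* Any subgraph of the square grid, of the hexagonal grid, or of the octagonal-square grid has a unit-cube contact representation.
   Context: A unit-cube contact representation of a graph $G$ assigns to each vertex an axis-aligned unit cube in $\mathbb{R}^3$ such that the cubes have pairwise disjoint interiors, and two cubes share a boundary region of non-zero area if and only if the corresponding vertices are adjacent in $G$. The square grid, hexagonal grid and octagonal-square grid are the (finite portions of the) graphs of the planar tilings by squares, by regular hexagons, and by regular octagons and squares (the 4.8.8 tiling), respectively. *)

(* Defs.v *)
From HB Require Import structures.
From mathcomp Require Import all_boot all_order all_algebra.
From mathcomp Require Import all_classical all_reals all_analysis.

Set Implicit Arguments.
Unset Strict Implicit.
Unset Printing Implicit Defensive.
Import Order.TTheory GRing.Theory Num.Theory.
Import numFieldNormedType.Exports.
Local Open Scope classical_set_scope.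
Local Open Scope ring_scope.

(* Simple graphs whose vertices form a (possibly infinite) subset of T. *)
Record sgraph (T : Type) := SGraph {
  vertices : set T;
  adj : T -> T -> Prop;
  adj_sym : forall x y, adj x y -> adj y x;
  adj_irrefl : forall x, ~ adj x x;
  adj_vertex : forall x y, adj x y -> vertices x }.

(* Not necessarily induced, not necessarily spanning. *)
Definition subgraph (T : Type) (H G : sgraph T) : Prop :=
  vertices H `<=` vertices G /\ (forall x y, adj H x y -> adj G x y).

Section Tilings.
Variable R : realType.

Definition rotation (t : R) (u : R * R) : R * R :=
  (cos t * u.1 - sin t * u.2, sin t * u.1 + cos t * u.2).

(* A regular polygon is given by its number of sides, its centre, and the
   vector from its centre to one of its corners. *)
Record regpoly := RegPoly {
  nsides : nat;
  centre : R * R;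
  spoke : R * R }.

(* The corners in cyclic order; periodic in k with period nsides P. *)
Definition corner (P : regpoly) (k : nat) : R * R :=
  centre P + rotation (2 * pi * k%:R / (nsides P)%:R) (spoke P).

Definition tiling_vertex (T : set regpoly) (x : R * R) : Prop :=
  exists P, T P /\ exists k : nat, x = corner P k.

(* x and y are the two endpoints of a side of a tile (the tilings below are
   edge-to-edge). *)
Definition tiling_adj (T : set regpoly) (x y : R * R) : Prop :=
  x <> y /\
  exists P, T P /\ exists k : nat,
    (x = corner P k /\ y = corner P k.+1) \/
    (y = corner P k /\ x = corner P k.+1).

Lemma tiling_adj_sym T x y : tiling_adj T x y -> tiling_adj T y x.
Proof.
move=> [xy [P [TP [k Hk]]]]; split; first by move=> yx; apply: xy.
by exists P; split=> //; exists k; case: Hk; [right|left].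
Qed.

Lemma tiling_adj_irrefl T x : ~ tiling_adj T x x.
Proof. by case. Qed.

Lemma tiling_adj_vertex T x y : tiling_adj T x y -> tiling_vertex T x.
Proof.
move=> [_ [P [TP [k [[-> _]|[_ ->]]]]]]; exists P; split=> //.
  by exists k.
by exists k.+1.
Qed.

Definition tiling_graph (T : set regpoly) : sgraph (R * R) :=
  SGraph (@tiling_adj_sym T) (@tiling_adj_irrefl T) (@tiling_adj_vertex T).

(* All tiles below have side length 1. *)

Definition square_tile (i j : int) : regpoly :=
  RegPoly 4 (i%:~R, j%:~R) (2^-1, 2^-1).

(* The centres form the lattice spanned by (3/2, sqrt 3 / 2) and (0, sqrt 3). *)
Definition hexagon_tile (i j : int) : regpoly :=
  RegPoly 6
    (3 / 2 * i%:~R, Num.sqrt 3 / 2 * i%:~R + Num.sqrt 3 * j%:~R)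
    (1, 0).

(* The 4.8.8 tiling: the octagons have two horizontal and two vertical sides,
   the latter shared with other octagons; the squares are turned by 45 degrees
   and fill the holes between four octagons. *)
Definition octagon_tile (i j : int) : regpoly :=
  RegPoly 8
    ((1 + Num.sqrt 2) * i%:~R, (1 + Num.sqrt 2) * j%:~R)
    (2^-1, (1 + Num.sqrt 2) / 2).

Definition gap_square_tile (i j : int) : regpoly :=
  RegPoly 4
    ((1 + Num.sqrt 2) * (i%:~R + 2^-1), (1 + Num.sqrt 2) * (j%:~R + 2^-1))
    (Num.sqrt 2 / 2, 0).

Definition square_grid : sgraph (R * R) :=
  tiling_graph [set P | exists i j, P = square_tile i j].

Definition hexagonal_grid : sgraph (R * R) :=
  tiling_graph [set P | exists i j, P = hexagon_tile i j].

Definition octagonal_square_grid : sgraph (R * R) :=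
  tiling_graph
    [set P | exists i j, P = octagon_tile i j \/ P = gap_square_tile i j].

End Tilings.

Section Cubes.
Variable R : realType.

Definition unit_cube (p : 'rV[R]_3) : set 'rV[R]_3 :=
  [set x | forall i, p 0 i <= x 0 i <= p 0 i + 1].

Definition boundary (A : set 'rV[R]_3) : set 'rV[R]_3 :=
  closure A `\` interior A.

(* The point of the plane {x | x_k = c} whose two remaining coordinates are,
   in order, y.1 and y.2. *)
Definition plane_point (k : 'I_3) (c : R) (y : R * R) : 'rV[R]_3 :=
  \row_j (if unlift k j is Some i then (if i == 0 then y.1 else y.2) else c).

Definition planar_slice (A : set 'rV[R]_3) (k : 'I_3) (c : R) : set (R * R) :=
  [set y | A (plane_point k c y)].

Definition area : set (R * R) -> \bar R :=
  (@lebesgue_measure R \x @lebesgue_measure R)%E.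

(* Only meant for A contained in finitely many axis-parallel planes, such as
   the common boundary of two axis-aligned cubes; the area of such an A is
   non-zero iff its part in one of these planes has non-zero area. *)
Definition nonzero_area (A : set 'rV[R]_3) : Prop :=
  exists (k : 'I_3) (c : R), area (planar_slice A k c) <> 0%E.

(* The vertex v is represented by the cube unit_cube (p v). *)
Definition unit_cube_contact_rep (T : Type) (G : sgraph T) (p : T -> 'rV[R]_3) :
    Prop :=
  forall v w, vertices G v -> vertices G w -> v <> w ->
    interior (unit_cube (p v)) `&` interior (unit_cube (p w)) = set0 /\
    (nonzero_area (boundary (unit_cube (p v)) `&` boundary (unit_cube (p w)))
     <-> adj G v w).

Definition has_unit_cube_contact_rep (T : Type) (G : sgraph T) : Prop :=
  exists p : T -> 'rV[R]_3, unit_cube_contact_rep G p.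

End Cubes.

(* Main.v *)
Require Import Defs.
From mathcomp Require Import all_boot all_order all_algebra.
From mathcomp Require Import all_classical all_reals all_analysis.
From mathcomp Require Import zify ring lra.

(* All three graphs embed in the graph on Z^2 with edges between points at
   distance 1, so it is enough to represent an arbitrary subgraph L of that
   graph.  The cube of (i, j) is put at
     (i - j/4 + s_j(i), j + t_i(j), 3/5 (i + j)),
   where s_j and t_i are nondecreasing with values in (-1/8, 1/8), and a step of
   s_j (resp. t_i) is zero exactly when the corresponding horizontal (resp.
   vertical) grid edge lies in L.  Grid neighbours then differ by exactly 1 or
   by more than 1 in the direction of their edge, and by less than 1 in the two
   other directions.  The z-coordinate separates
   (i, j) from (i+1, j+1), the shear -j/4 separates (i, j) from (i+1, j-1), and
   all other pairs differ by more than 1 in x or y. *)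

Set Implicit Arguments.
Unset Strict Implicit.
Unset Printing Implicit Defensive.
Import Order.TTheory GRing.Theory Num.Theory.
Import numFieldNormedType.Exports.
Local Open Scope classical_set_scope.
Local Open Scope ring_scope.

(** * Bounded nondecreasing functions on the integers with prescribed flat steps *)

Section Drift.
Variable R : realType.

(** Steps are summed outwards from 0. The step at [i] is zero on [A] and otherwise a term of a
    geometric series of total 1/8, with one such series for each half-line, so even infinitely many
    positive steps stay within the bounds. *)
Lemma drift (A : int -> Prop) : exists s : int -> R,
  [/\ forall i, - (1 / 8) < s i < 1 / 8,
      forall i, A i -> s (i + 1) = s i
    & forall i, ~ A i -> s i < s (i + 1)].
Proof.
pose h (k : nat) : R := 2^-1 ^+ k / 16.
have h_gt0 k : 0 < h k by rewrite divr_gt0 ?exprn_gt0 ?invr_gt0.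
pose w (i : int) k : R := if `[< A i >] then 0 else h k.
have w_ge0 i k : 0 <= w i k by rewrite /w; case: ifP => // _; exact: ltW.
pose S (f : nat -> int) n := \sum_(k < n) w (f k) k.
have S_ge0 f n : 0 <= S f n by apply: sumr_ge0.
have S_lt f n : S f n < 1 / 8.
  (* [2 * h n] is the tail of the series from index [n] on; keeping it makes the induction work and
     the bound strict. *)
  suff : S f n <= 1 / 8 - 2 * h n by have := h_gt0 n; lra.
  elim: n => [|n IH]; first by rewrite /S big_ord0 /h expr0; lra.
  rewrite /S big_ord_recr /= -/(S f n).
  have : w (f n) n <= h n by rewrite /w; case: ifP => // _; exact: ltW.
  have : h n.+1 = h n / 2 by rewrite /h exprS; ring.
  lra.
pose s (i : int) : R := match i with
  | Posz n => S Posz n | Negz n => - S Negz n.+1 end.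
(* The weight index is [n] both for [Posz n] and for [Negz n], whose absolute value is [n.+1]. *)
have sS i : s (i + 1) = s i + w i (`|i| - (i < 0)%R)%N.
  case: i => [n|[|n]].
  - have -> : Posz n + 1 = Posz n.+1 by lia.
    by rewrite /= /S big_ord_recr /= subn0.
  - by rewrite /= /S big_ord1 big_ord0 subn1 /= addNr.
  - have -> : Negz n.+1 + 1 = Negz n by rewrite !NegzE; lia.
    by rewrite /= /S [in RHS]big_ord_recr /= subn1 /=; ring.
exists s; split => [[n|n]|i Ai|i nAi].
- by have := S_ge0 Posz n; have := S_lt Posz n; rewrite /s; lra.
- by have := S_ge0 Negz n.+1; have := S_lt Negz n.+1; rewrite /s; lra.
- by rewrite sS /w asboolT ?addr0.
- by rewrite sS /w asboolF // ltrDl.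
Qed.

Lemma drifts (A : int -> int -> Prop) : exists s : int -> int -> R,
  [/\ forall j i, - (1 / 8) < s j i < 1 / 8,
      forall j i, A j i -> s j (i + 1) = s j i
    & forall j i, ~ A j i -> s j i < s j (i + 1)].
Proof.
have [s sP] := choice (fun j => drift (A j)).
by exists s; split=> j; have [] := sP j.
Qed.

End Drift.

(** * Contacts of unit cubes read off from coordinate differences *)

Section CubeContacts.
Variable R : realType.
Implicit Types p q x : 'rV[R]_3.

Definition separated p q := exists k, 1 < `|p 0 k - q 0 k|.

(** The cubes abut across a plane orthogonal to axis [k], and their projections along [k] overlap in
    a nondegenerate rectangle. *)
Definition touching p q :=
  exists k, `|p 0 k - q 0 k| = 1 /\ forall j, j != k -> `|p 0 j - q 0 j| < 1.

Lemma separated_unit_cube p q :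
  separated p q -> unit_cube p `&` unit_cube q = set0.
Proof.
move=> [k pq]; rewrite -subset0 => x [/(_ k) px /(_ k) qx].
move: pq; rewrite ltNge => /negP; apply; rewrite ler_norml.
by move: px qx; rewrite /=; lra.
Qed.

Lemma closed_unit_cube p : closed (unit_cube p).
Proof.
have -> : unit_cube p = \bigcap_i
    ((fun x : 'rV[R]_3 => x 0 i) @^-1` [set` `[p 0 i, p 0 i + 1]]).
  apply/seteqP; split => [x px i _ | x px i].
    by rewrite /= in_itv /= px.
  by have := px i I; rewrite /= in_itv.
apply: closed_bigI => i _; apply: closed_comp.
  by move=> x _; exact: coord_continuous.
exact: itv_closed.
Qed.

Lemma interior_unit_cube p x :
  interior (unit_cube p) x -> forall i, p 0 i < x 0 i < p 0 i + 1.
Proof.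
move=> /nbhs_ballP[e /= e0 xe] i.
(* Adding [d] to all coordinates moves [x] by [|d|] in the sup norm, hence stays in the ball. *)
have shift_mem (d : R) : `|d| < e -> p 0 i <= x 0 i + d <= p 0 i + 1.
  move=> de; have /= := xe (\row_j (x 0 j + d)); rewrite /unit_cube /=.
  move=> /(_ _ i); rewrite mxE; apply; split => // a b; rewrite ord1 mxE.
  by rewrite /ball /= opprD addrA subrr add0r normrN.
have e2 : 0 < e / 2 by rewrite divr_gt0.
have := shift_mem (e / 2); have := shift_mem (- (e / 2)).
rewrite normrN gtr0_norm // ltr_pdivrMr // ltr_pMr // ltr1n.
by move=> /(_ isT) ? /(_ isT) ?; lra.
Qed.

Lemma boundary_unit_cube_sub p : boundary (unit_cube p) `<=` unit_cube p.
Proof.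
by move=> x [+ _]; rewrite -(closure_id _).1 //; exact: closed_unit_cube.
Qed.

Lemma face_boundary p x k : unit_cube p x ->
  x 0 k = p 0 k \/ x 0 k = p 0 k + 1 -> boundary (unit_cube p) x.
Proof.
move=> px xk; split; first exact: subset_closure.
by move=> /interior_unit_cube/(_ k); case: xk => ->; rewrite ltxx ?andbF.
Qed.

Lemma touching_interior p q : touching p q ->
  interior (unit_cube p) `&` interior (unit_cube q) = set0.
Proof.
move=> [k [pq _]]; rewrite -subset0.
move=> x [/interior_unit_cube/(_ k) px /interior_unit_cube/(_ k) qx].
have : `|p 0 k - q 0 k| < 1 by rewrite ltr_norml; lra.
by rewrite pq ltxx.
Qed.

Lemma area_rectangle (a b c d : R) : a < b -> c < d ->
  area ([set` `[a, b]] `*` [set` `[c, d]]) <> 0%E.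
Proof.
move=> ab cd; rewrite /area product_measure1E //.
rewrite /= !lebesgue_measure_itv /= !lte_fin ab cd -!EFinD -EFinM.
by move=> [] /eqP; rewrite mulf_eq0 !subr_eq0 !gt_eqF.
Qed.

Lemma touching_area p q : touching p q ->
  nonzero_area (boundary (unit_cube p) `&` boundary (unit_cube q)).
Proof.
move=> [k [pqk pqj]].
pose lo j := Num.max (p 0 j) (q 0 j).
pose hi j := Num.min (p 0 j + 1) (q 0 j + 1).
have lohi j : j != k -> lo j < hi j.
  move=> /pqj; rewrite ltr_norml => ?.
  by rewrite /lo /hi lt_min !gt_max; lra.
(* As the two [k]-coordinates differ by 1, the larger one is the lower face of one cube and the
   upper face of the other: this is the plane of contact. *)
exists k, (lo k).
rewrite (_ : planar_slice _ _ _ =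
  [set` `[lo (lift k 0), hi (lift k 0)]] `*` [set` `[lo (lift k 1), hi (lift k 1)]]).
  by apply: area_rectangle; apply: lohi; rewrite eq_sym neq_lift.
have itvE (u : R) j : (u \in `[lo j, hi j]) =
    (p 0 j <= u <= p 0 j + 1) && (q 0 j <= u <= q 0 j + 1).
  by rewrite in_itv /= ge_max le_min; do !case: (_ <= _).
apply/seteqP; split => [y [/boundary_unit_cube_sub py /boundary_unit_cube_sub qy]|y].
  split; rewrite /= itvE.
    by have := py (lift k 0); have := qy (lift k 0); rewrite !mxE liftK /= => -> ->.
  by have := py (lift k 1); have := qy (lift k 1); rewrite !mxE liftK /= => -> ->.
move=> [] /=; rewrite !itvE => /andP[p1 q1] /andP[p2 q2].
have cube (r : 'rV[R]_3) : r 0 k <= lo k <= r 0 k + 1 ->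
    r 0 (lift k 0) <= y.1 <= r 0 (lift k 0) + 1 ->
    r 0 (lift k 1) <= y.2 <= r 0 (lift k 1) + 1 ->
    unit_cube r (plane_point k (lo k) y).
  move=> rk r0 r1 i; rewrite mxE; case: unliftP => [j ->|->] //.
  by case: (unliftP 0 j) => [j' ->|->] //=; rewrite (ord1 j') (_ : lift 0 0 = 1) //; apply/val_inj.
have ok : p 0 k = q 0 k + 1 /\ lo k = p 0 k \/ q 0 k = p 0 k + 1 /\ lo k = q 0 k.
  move: pqk; rewrite /lo; case: (ltrP (p 0 k) (q 0 k)) => h pqk.
    by right; split=> //; lra.
  by left; split=> //; lra.
split; apply: (@face_boundary _ _ k); rewrite ?mxE ?unlift_none.
- by apply: cube => //; lra.
- by lra.
- by apply: cube => //; lra.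
- by lra.
Qed.

Lemma separated_area p q : separated p q ->
  ~ nonzero_area (boundary (unit_cube p) `&` boundary (unit_cube q)).
Proof.
move=> /separated_unit_cube pq [k [c]]; apply.
rewrite (_ : planar_slice _ _ _ = set0) ?measure0 // -subset0 => y.
move=> [/boundary_unit_cube_sub py /boundary_unit_cube_sub qy].
have : (unit_cube p `&` unit_cube q) (plane_point k c y) by [].
by rewrite pq.
Qed.

(** From here on interiors, boundaries and areas are replaced by inequalities between
    coordinates. *)
Lemma contact_rep_of_touching (T : Type) (G : sgraph T) (P : T -> 'rV[R]_3) :
  (forall v w, adj G v w -> touching (P v) (P w)) ->
  (forall v w, vertices G v -> vertices G w -> v <> w -> ~ adj G v w ->
    separated (P v) (P w)) ->
  unit_cube_contact_rep G P.
Proof.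
move=> adjP nadjP v w Gv Gw vw; have [avw|navw] := pselect (adj G v w).
  have tvw := adjP _ _ avw.
  by split; [exact: touching_interior|split => // _; exact: touching_area].
have svw := nadjP _ _ Gv Gw vw navw; split.
  rewrite -subset0 -(separated_unit_cube svw).
  by apply: setISS; exact: interior_subset.
by split => // /(separated_area svw).
Qed.

End CubeContacts.

(** * Placing cubes over the integer grid *)

Section GridPlacement.
Variable R : realType.

Lemma separatedC (p q : 'rV[R]_3) : separated p q -> separated q p.
Proof. by move=> [k]; rewrite distrC; exists k. Qed.

Lemma touchingC (p q : 'rV[R]_3) : touching p q -> touching q p.
Proof.
by move=> [k [pq pqj]]; exists k; split=> [|j /pqj]; rewrite distrC.
Qed.

Definition vec3 (x y z : R) : 'rV[R]_3 := \row_(k < 3) [:: x; y; z]`_k.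

Lemma separated_vec3 x y z x' y' z' :
  [|| 1 < `|x - x'|, 1 < `|y - y'| | 1 < `|z - z'|] ->
  separated (vec3 x y z) (vec3 x' y' z').
Proof.
case/or3P => h; [exists (@Ordinal 3 0 isT)|exists (@Ordinal 3 1 isT)|
  exists (@Ordinal 3 2 isT)]; by rewrite !mxE.
Qed.

Lemma touching_vec3x x y z x' y' z' :
  `|x - x'| = 1 -> `|y - y'| < 1 -> `|z - z'| < 1 ->
  touching (vec3 x y z) (vec3 x' y' z').
Proof.
move=> hx hy hz; exists (@Ordinal 3 0 isT); split=> [|j]; rewrite !mxE //.
by case: j => [[|[|[|]]]].
Qed.

Lemma touching_vec3y x y z x' y' z' :
  `|x - x'| < 1 -> `|y - y'| = 1 -> `|z - z'| < 1 ->
  touching (vec3 x y z) (vec3 x' y' z').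
Proof.
move=> hx hy hz; exists (@Ordinal 3 1 isT); split=> [|j]; rewrite !mxE //.
by case: j => [[|[|[|]]]].
Qed.

Definition grid_adj (c d : int * int) : Prop :=
  `|c.1 - d.1| + `|c.2 - d.2| = 1.

Lemma grid_placement (L : int * int -> int * int -> Prop) :
  (forall c d, L c d -> L d c) ->
  exists P : int * int -> 'rV[R]_3,
    (forall c d, grid_adj c d -> L c d -> touching (P c) (P d)) /\
    (forall c d, c <> d -> ~ L c d -> separated (P c) (P d)).
Proof.
move=> Lsym.
have [s [s_bnd sA snA]] := drifts R (fun j i => L (i, j) (i + 1, j)).
have [t [t_bnd tA tnA]] := drifts R (fun i j => L (i, j) (i, j + 1)).
(* The factor 3/5 lies between 1/2 and 1, so z changes by less than 1 along a grid edge but by 6/5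
   from (i, j) to (i+1, j+1). Two drifts differ by strictly less than 1/4, so the shear 1/4 just
   suffices for (i+1, j-1). *)
pose P (c : int * int) := vec3
  (c.1%:~R - c.2%:~R / 4 + s c.2 c.1) (c.2%:~R + t c.1 c.2)
  (3 / 5 * (c.1%:~R + c.2%:~R)).
have touch_right i j : L (i, j) (i + 1, j) -> touching (P (i, j)) (P (i + 1, j)).
  move=> Lij; have := t_bnd i j; have := t_bnd (i + 1) j; have := sA _ _ Lij.
  rewrite /P /= => -> ? ?; rewrite intrD; apply: touching_vec3x.
  - by rewrite ltr0_norm; lra.
  - by rewrite ltr_norml; lra.
  - by rewrite ltr_norml; lra.
have touch_up i j : L (i, j) (i, j + 1) -> touching (P (i, j)) (P (i, j + 1)).
  move=> Lij; have := s_bnd j i; have := s_bnd (j + 1) i; have := tA _ _ Lij.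
  rewrite /P /= => -> ? ?; rewrite intrD; apply: touching_vec3y.
  - by rewrite ltr_norml; lra.
  - by rewrite ltr0_norm; lra.
  - by rewrite ltr_norml; lra.
(* [L] and [separated] are symmetric, so one order of the abscissas is enough. Distant pairs are
   treated first, leaving only differences of at most 1 in both indices. *)
have sep_le c d : c.1 <= d.1 -> c <> d -> ~ L c d -> separated (P c) (P d).
  case: c d => [i j] [i' j'] /= ii' cd nL.
  have := s_bnd j i; have := s_bnd j' i'; have := t_bnd i j; have := t_bnd i' j'.
  move=> tb' tb sb' sb; apply: separated_vec3 => /=.
  have [jj|jj] := boolP (j + 2 <= j').
    have : (j + 2)%:~R <= j'%:~R :> R by rewrite ler_int.
    rewrite intrD => ?; apply/or3P/Or32; rewrite lter_normr; apply/orP; right.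
    by lra.
  have [jj'|jj'] := boolP (j' + 2 <= j).
    have : (j' + 2)%:~R <= j%:~R :> R by rewrite ler_int.
    rewrite intrD => ?; apply/or3P/Or32; rewrite lter_normr; apply/orP; left.
    by lra.
  have {}jj : (j' <= j + 1)%R by lia.
  have {}jj' : (j <= j' + 1)%R by lia.
  have [ii|ii] := boolP (i + 2 <= i').
    have : (i + 2)%:~R <= i'%:~R :> R by rewrite ler_int.
    have : j'%:~R <= (j + 1)%:~R :> R by rewrite ler_int.
    have : j%:~R <= (j' + 1)%:~R :> R by rewrite ler_int.
    rewrite !intrD => ? ? ?; apply/or3P/Or31; rewrite lter_normr; apply/orP.
    by right; lra.
  have [ei|ei] : i' = i \/ i' = i + 1 by lia.
    have [ej|[ej|ej]] : j' = j \/ j' = j + 1 \/ j = j' + 1 by lia.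
    - by case: cd; rewrite ei ej.
    - subst; have := tnA _ _ nL; rewrite intrD => ?.
      apply/or3P/Or32; rewrite lter_normr; apply/orP; right.
      by lra.
    - subst; have := tnA _ _ (fun h => nL (Lsym _ _ h)); rewrite intrD => ?.
      apply/or3P/Or32; rewrite lter_normr; apply/orP; left.
      by lra.
  have [ej|[ej|ej]] : j' = j \/ j' = j + 1 \/ j = j' + 1 by lia.
  - subst; have := snA _ _ nL; rewrite intrD => ?.
    apply/or3P/Or31; rewrite lter_normr; apply/orP; right.
    by lra.
  - subst; rewrite !intrD; apply/or3P/Or33; rewrite lter_normr; apply/orP; right.
    by lra.
  - subst; rewrite !intrD; apply/or3P/Or31; rewrite lter_normr; apply/orP; right.
    by lra.
exists P; split=> [[i j] [i' j']|c d].
  rewrite /grid_adj /= => adj Lcd.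
  have : (i' = i + 1 /\ j' = j) \/ (i = i' + 1 /\ j' = j) \/
         (i' = i /\ j' = j + 1) \/ (i' = i /\ j = j' + 1) by lia.
  case=> [[? ?]|[[? ?]|[[? ?]|[? ?]]]]; subst.
  - exact: touch_right.
  - exact/touchingC/touch_right/Lsym.
  - exact: touch_up.
  - exact/touchingC/touch_up/Lsym.
have [cd|/ltW dc] := lerP c.1 d.1; first exact: sep_le.
by move=> ne nL; apply: separatedC; apply: sep_le => // [/esym|/Lsym].
Qed.

(** [L] is taken to be the image of the edges of [G] under [f], so non-adjacent vertices sent to
    grid neighbours are still separated. Injectivity turns [L (f v) (f w)] back into [adj G v w]. *)
Lemma grid_contact_rep (T : Type) (G : sgraph T) (f : T -> int * int) :
  (forall v w, vertices G v -> vertices G w -> f v = f w -> v = w) ->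
  (forall v w, adj G v w -> grid_adj (f v) (f w)) ->
  has_unit_cube_contact_rep R G.
Proof.
move=> f_inj f_adj.
have [|P [Ptouch Psep]] := grid_placement
    (L := fun c d => exists v w, [/\ adj G v w, f v = c & f w = d]).
  by move=> c d [v [w [vw vc wd]]]; exists w, v; split=> //; exact: adj_sym.
exists (P \o f); apply: contact_rep_of_touching => [v w vw|v w Gv Gw vw nvw].
  by apply: Ptouch; [exact: f_adj|exists v, w].
apply: Psep => [/f_inj|]; first by move=> /(_ Gv Gw).
move=> [v' [w' [vw' /f_inj ev /f_inj ew]]]; apply: nvw.
by rewrite -(ev (adj_vertex vw') Gv) -(ew (adj_vertex (adj_sym vw')) Gw).
Qed.

End GridPlacement.

(** * Embedding the three tilings in the integer grid *)

Section TilingGraphs.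
Variable R : realType.

(** [I] names the tiling vertices: [pt] locates a name in the plane and [code] in the integer grid.
    The embedding is [code] after the inverse of [pt], and it suffices to check edges tile by
    tile. *)
Lemma tiling_contact_rep (T : set (regpoly R)) (I : Type) (pt : I -> R * R)
    (code : I -> int * int) (G : sgraph (R * R)%type) :
  injective pt -> injective code ->
  (forall P, T P -> forall k, exists a b,
    [/\ corner P k = pt a, corner P k.+1 = pt b & grid_adj (code a) (code b)]) ->
  subgraph G (tiling_graph T) -> has_unit_cube_contact_rep R G.
Proof.
move=> pt_inj code_inj sides [GV GE].
have /choice[f fP] : forall x, exists c, vertices G x ->
    exists a, x = pt a /\ c = code a.
  move=> x; have [Gx|nGx] := pselect (vertices G x); last by exists (0, 0).
  have [P [TP [k ->]]] := GV _ Gx.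
  by have [a [_ [-> _ _]]] := sides _ TP k; exists (code a) => _; exists a.
have f_pt a : vertices G (pt a) -> f (pt a) = code a.
  by move=> /fP[b [/pt_inj <-]].
apply: (@grid_contact_rep _ _ _ f) => [x y /fP[a [-> ->]] /fP[b [-> ->]]|x y xy].
  by move=> /code_inj ->.
have Gx := adj_vertex xy; have Gy := adj_vertex (adj_sym xy).
have [_ [P [TP [k exy]]]] := GE _ _ xy; have [a [b [ea eb ab]]] := sides _ TP k.
move: Gx Gy; rewrite ea eb in exy.
case: exy => -[-> ->] /f_pt -> /f_pt -> //.
by move: ab; rewrite /grid_adj distrC [X in _ + X]distrC.
Qed.

Lemma rotationD (a b : R) u : rotation (a + b) u = rotation a (rotation b u).
Proof. by rewrite /rotation cosD sinD /=; congr pair; ring. Qed.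

(** Reduces a tile to finitely many algebraic checks. [l] lists the corners relative to the centre;
    each is the previous one turned by one n-th of a full turn, and the index modulo n closes the
    cycle. *)
Lemma tile_sides (P : regpoly R) (I : Type) (pt : I -> R * R)
    (code : I -> int * int) (c s : R) (l : seq (R * R)) (a : nat -> I) :
  cos (2 * pi / (nsides P)%:R) = c /\ sin (2 * pi / (nsides P)%:R) = s ->
  (0 < nsides P)%N -> l`_0 = spoke P ->
  (forall r, (r < nsides P)%N -> l`_(r.+1 %% nsides P) =
    (c * (l`_r).1 - s * (l`_r).2, s * (l`_r).1 + c * (l`_r).2)) ->
  (forall r, (r < nsides P)%N -> centre P + l`_r = pt (a r)) ->
  (forall r, (r < nsides P)%N ->
    grid_adj (code (a r)) (code (a (r.+1 %% nsides P)%N))) ->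
  forall k, exists a b,
    [/\ corner P k = pt a, corner P k.+1 = pt b & grid_adj (code a) (code b)].
Proof.
set n := nsides P => -[hc hs] n_gt0 l0 lS ptE adjE.
have modS k : (k.+1 %% n = (k %% n).+1 %% n)%N by rewrite -addn1 -modnDml addn1.
have cornerE k : corner P k = pt (a (k %% n)%N).
  rewrite -ptE ?ltn_mod // /corner -/n; congr (_ + _).
  elim: k => [|k IH].
    rewrite mulr0 mul0r mod0n l0 /rotation cos0 sin0 !mul1r !mul0r subr0 add0r.
    by case: (spoke P).
  have -> : 2 * pi * k.+1%:R / n%:R =
      2 * pi / n%:R + 2 * pi * k%:R / n%:R :> R by rewrite -natr1; ring.
  by rewrite rotationD IH modS lS ?ltn_mod // /rotation hc hs.
move=> k; exists (a (k %% n)%N), (a (k.+1 %% n)%N).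
by rewrite !cornerE modS; split=> //; apply: adjE; rewrite ltn_mod.
Qed.

Lemma cos_sin_quarter : cos (2 * pi / 4) = 0 :> R /\ sin (2 * pi / 4) = 1 :> R.
Proof.
have -> : 2 * pi / 4 = pi / 2 :> R by field.
by rewrite cos_pihalf sin_pihalf.
Qed.

Lemma cos_sin_sixth :
  cos (2 * pi / 6) = 1 / 2 :> R /\ sin (2 * pi / 6) = Num.sqrt 3 / 2 :> R.
Proof.
have -> : 2 * pi / 6 = pi / 3 :> R by field.
have pi0 := pi_gt0 R; set x : R := pi / 3.
have c0 : 0 < cos x by apply: cos_gt0_pihalf; rewrite /x; lra.
have s0 : 0 < sin x by apply: sin_gt0_pi; rewrite /x; lra.
have cs := cos2Dsin2 x.
(* The triple angle formula 4 c^3 - 3 c = -1, factored. *)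
have c3 : (cos x + 1) * (2 * cos x - 1) ^+ 2 = 0.
  have : cos (x + (x + x)) = -1 by rewrite -cospi; congr cos; rewrite /x; field.
  rewrite !cosD !sinD => h.
  have es : sin x ^+ 2 = 1 - cos x ^+ 2 by lra.
  have : cos x * cos x * cos x - 3 * cos x * sin x ^+ 2 = -1 by rewrite -h; ring.
  by rewrite es; lra.
have c12 : cos x = 1 / 2.
  move/eqP: c3; rewrite mulf_eq0 sqrf_eq0 => /orP[] /eqP; lra.
split=> //; apply/eqP; rewrite -(eqrXn2 (n := 2)) ?ltW ?divr_gt0 ?sqrtr_gt0 //.
rewrite exprMn sqr_sqrtr //; apply/eqP.
by move: cs; rewrite c12; lra.
Qed.

Lemma cos_sin_eighth :
  cos (2 * pi / 8) = Num.sqrt 2 / 2 :> R /\ sin (2 * pi / 8) = Num.sqrt 2 / 2 :> R.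
Proof.
have -> : 2 * pi / 8 = pi / 4 :> R by field.
have pi0 := pi_gt0 R; set x : R := pi / 4.
have c0 : 0 < cos x by apply: cos_gt0_pihalf; rewrite /x; lra.
have s0 : 0 < sin x by apply: sin_gt0_pi; rewrite /x; lra.
have cs := cos2Dsin2 x.
(* The double angle formula at pi/4. *)
have c2 : cos x ^+ 2 *+ 2 - 1 = 0.
  by rewrite -cos_mulr2n -[RHS]cos_pihalf; congr cos; rewrite /x; field.
have r2 : (Num.sqrt 2 / 2) ^+ 2 = 1 / 2 :> R.
  by rewrite exprMn sqr_sqrtr //; field.
by split; apply/eqP; rewrite -(eqrXn2 (n := 2)) ?ltW ?divr_gt0 ?sqrtr_gt0 // r2;
  apply/eqP; lra.
Qed.

Lemma square_grid_contact_rep (G : sgraph (R * R)%type) :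
  subgraph G (square_grid R) -> has_unit_cube_contact_rep R G.
Proof.
(* Tiles are centred at integer points; [a] names the lower left corner of the tile centred at
   [a]. *)
pose pt (a : int * int) : R * R := (a.1%:~R - 1 / 2, a.2%:~R - 1 / 2).
apply: (tiling_contact_rep (pt := pt) (code := id)) => //.
  by move=> [a b] [a' b'] [] /addIr/intr_inj -> /addIr/intr_inj ->.
move=> _ [i [j ->]].
apply: (tile_sides (P := square_tile R i j) (pt := pt) (code := id)
  (l := [:: (1/2, 1/2); (-(1/2), 1/2); (-(1/2), -(1/2)); (1/2, -(1/2))])
  (a := nth (0, 0) [:: (i + 1, j + 1); (i, j + 1); (i, j); (i + 1, j)])
  cos_sin_quarter) => //=; first by rewrite !mul1r.
- by move=> [|[|[|[|]]]] //= _; congr pair; lra.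
- by move=> [|[|[|[|]]]] //= _; rewrite /pt /= ?intrD; congr pair => /=; lra.
- by move=> [|[|[|[|]]]] //= _; rewrite /grid_adj /=; lia.
Qed.

Lemma hexagonal_grid_contact_rep (G : sgraph (R * R)%type) :
  subgraph G (hexagonal_grid R) -> has_unit_cube_contact_rep R G.
Proof.
(* Zigzags of the honeycomb become columns of Z^2: the column index is a.1, and
   the abscissa, in half units, is 3 a.1 + 1 or 3 a.1 + 2 depending on parity. *)
pose m (a : int * int) : int := 3 * a.1 + 1 + ((a.1 + a.2 + 1) %% 2)%Z.
pose h : R := Num.sqrt 3 / 2.
have h0 : 0 < h by rewrite divr_gt0 ?sqrtr_gt0.
have hh : h * h = 3 / 4.
  by rewrite -expr2 exprMn sqr_sqrtr //; field.
pose pt (a : int * int) : R * R := ((m a)%:~R / 2, a.2%:~R * h).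
apply: (tiling_contact_rep (pt := pt) (code := id)) => //.
  move=> [a b] [a' b'] [] /mulIf mm /mulIf bb.
  have eb : b = b' by apply/(@intr_inj R)/bb; rewrite gt_eqF.
  have : m (a, b) = m (a', b') by apply/(@intr_inj R)/mm; rewrite invr_eq0 pnatr_eq0.
  by rewrite /m /= eb => e; congr pair; lia.
move=> _ [i [j ->]].
(* The hexagon becomes a brick: the six grid points in columns [i - 1], [i] and the three rows
   around [i + 2 * j], the row of its centre. *)
apply: (tile_sides (P := hexagon_tile R i j) (pt := pt) (code := id)
  (l := [:: (1, 0); (1/2, h); (-(1/2), h); (-1, 0); (-(1/2), -h); (1/2, -h)])
  (a := nth (0, 0) [:: (i, i + 2 * j); (i, i + 2 * j + 1);
     (i - 1, i + 2 * j + 1); (i - 1, i + 2 * j); (i - 1, i + 2 * j - 1);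
     (i, i + 2 * j - 1)])
  cos_sin_sixth) => //=.
- by rewrite -/h; move=> [|[|[|[|[|[|]]]]]] //= _; congr pair; lra.
- have ptE (x y : R) (a : int * int) (u : int) : m a = u ->
      u%:~R = 3 * i%:~R + 2 * x -> a.2%:~R * h = (i%:~R + 2 * j%:~R) * h + y ->
      (3 / 2 * i%:~R, Num.sqrt 3 / 2 * i%:~R + Num.sqrt 3 * j%:~R) + (x, y) = pt a.
    move=> ma ex ey; rewrite /pt ma ex ey; congr pair => /=; first by lra.
    by rewrite /h; lra.
  move=> [|[|[|[|[|[|]]]]]] //= _; [apply: (ptE _ _ _ (3 * i + 2))|
    apply: (ptE _ _ _ (3 * i + 1))|apply: (ptE _ _ _ (3 * i - 1))|
    apply: (ptE _ _ _ (3 * i - 2))|apply: (ptE _ _ _ (3 * i - 1))|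
    apply: (ptE _ _ _ (3 * i + 1))]; rewrite ?/m /= ?rmorphB ?rmorphD ?rmorphM  /=;
    by [lia|lra].
- by move=> [|[|[|[|[|[|]]]]]] //= _; rewrite /grid_adj /=; lia.
Qed.

(** If [m] and [n] differed, the left-hand terms would differ by at least [1 + r], but the others
    differ by at most [r]. *)
Lemma octagonal_coord_inj (r : R) (m n u v : int) : 0 < r -> `|u - v| <= 2 ->
  (1 + r) * (m%:~R + 2^-1) + r / 2 * u%:~R =
  (1 + r) * (n%:~R + 2^-1) + r / 2 * v%:~R -> m = n /\ u = v.
Proof.
move=> r0 uv e.
have {}e : (1 + r) * (m - n)%:~R = r / 2 * (v - u)%:~R by rewrite !intrB; lra.
have ler (a b : int) : a <= b -> a%:~R <= b%:~R :> R by rewrite ler_int.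
have mn : m = n.
  have lo : - 2 <= (v - u)%:~R :> R by apply: (ler (-2)); lia.
  have hi : (v - u)%:~R <= 2 :> R by apply: (ler _ 2); lia.
  case: (ltrgtP m n) => // mn; exfalso.
    have : (m - n)%:~R <= -1 :> R by apply: (ler _ (-1)); lia.
    by move: (m - n)%:~R (v - u)%:~R e lo hi => M V; nra.
  have : 1 <= (m - n)%:~R :> R by apply: (ler 1); lia.
  by move: (m - n)%:~R (v - u)%:~R e lo hi => M V; nra.
split=> //; move/eqP: e.
rewrite mn subrr mulr0 eq_sym mulf_eq0 gt_eqF ?divr_gt0 //=.
by rewrite intr_eq0 subr_eq0 => /eqP.
Qed.

Lemma octagonal_square_grid_contact_rep (G : sgraph (R * R)%type) :
  subgraph G (octagonal_square_grid R) -> has_unit_cube_contact_rep R G.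
Proof.
pose r : R := Num.sqrt 2.
have r0 : 0 < r by rewrite sqrtr_gt0.
have rr : r * r = 2 by rewrite -expr2 sqr_sqrtr.
(* a.1 is a gap square and a.2 one of its corners, named by the corresponding
   corner of [0, 1]^2.  In Z^2 the gap squares become the translates of [0, 1]^2
   by the lattice spanned by (2, 1) and (-1, 2). *)
pose I := ((int * int) * (bool * bool))%type.
(* Offsets from the centre of the gap square, in units of [r / 2]: turning [0, 1]^2 clockwise by 45
   degrees sends (1,1), (0,1), (0,0), (1,0) to the right, top, left and bottom corners. *)
pose dx (a : I) : int := a.2.1%:Z + a.2.2%:Z - 1.
pose dy (a : I) : int := a.2.2%:Z - a.2.1%:Z.
pose pt (a : I) : R * R :=
  ((1 + r) * (a.1.1%:~R + 2^-1) + r / 2 * (dx a)%:~R,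
   (1 + r) * (a.1.2%:~R + 2^-1) + r / 2 * (dy a)%:~R).
pose code (a : I) : int * int :=
  (2 * a.1.1 - a.1.2 + a.2.1%:Z, a.1.1 + 2 * a.1.2 + a.2.2%:Z).
apply: (tiling_contact_rep (pt := pt) (code := code)).
- move=> [[i j] [e f]] [[i' j'] [e' f']] [].
  move=> /(octagonal_coord_inj r0) hx /(octagonal_coord_inj r0) hy.
  have [|-> eu] := hx; first by rewrite /dx /=; lia.
  have [|-> ev] := hy; first by rewrite /dy /=; lia.
  by move: eu ev; clear; case: e e' f f' => [] [] [] [].
- move=> [[i j] [e f]] [[i' j'] [e' f']]; rewrite /code /= => -[h1 h2].
  (* The lattice has index 5, and x - 2y modulo 5 vanishes on it while taking the distinct values 0,
     1, 3, 4 on the corners of [0, 1]^2. *)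
  have [] : i = i' /\ j = j' /\ e = e' /\ f = f'.
    by move: h1 h2; case: e e' f f' => [] [] [] [] /=; lia.
  by move=> -> [-> [-> ->]].
move=> _ [i [j [->|->]]].
(* The octagon becomes the ring of eight grid points around (2i - j, i + 2j - 1), a point that no
   gap square covers. *)
- apply: (tile_sides (P := octagon_tile R i j) (pt := pt) (code := code)
    (l := [:: (1/2, (1+r)/2); (-(1/2), (1+r)/2); (-((1+r)/2), 1/2);
              (-((1+r)/2), -(1/2)); (-(1/2), -((1+r)/2)); (1/2, -((1+r)/2));
              ((1+r)/2, -(1/2)); ((1+r)/2, 1/2)])
    (a := nth ((0, 0), (true, true)) [:: ((i, j), (false, false));
       ((i - 1, j), (true, true)); ((i - 1, j), (true, false));
       ((i - 1, j - 1), (false, true)); ((i - 1, j - 1), (true, true));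
       ((i, j - 1), (false, false)); ((i, j - 1), (false, true));
       ((i, j), (true, false))])
    cos_sin_eighth) => //=.
  + by rewrite mul1r.
  + by rewrite -/r; move=> [|[|[|[|[|[|[|[|]]]]]]]] //= _; congr pair; nra.
  + by move=> [|[|[|[|[|[|[|[|]]]]]]]] //= _; rewrite /pt /dx /dy /= -/r ?intrD;
      congr pair => /=; nra.
  + by move=> [|[|[|[|[|[|[|[|]]]]]]]] //= _; rewrite /grid_adj /code /=; lia.
- apply: (tile_sides (P := gap_square_tile R i j) (pt := pt) (code := code)
    (l := [:: (r/2, 0); (0, r/2); (-(r/2), 0); (0, -(r/2))])
    (a := nth ((0, 0), (true, true)) [:: ((i, j), (true, true));
       ((i, j), (false, true)); ((i, j), (false, false));
       ((i, j), (true, false))])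
    cos_sin_quarter) => //=.
  + by move=> [|[|[|[|]]]] //= _; congr pair; lra.
  + by move=> [|[|[|[|]]]] //= _; rewrite /pt /dx /dy /= -/r; congr pair => /=; lra.
  + by move=> [|[|[|[|]]]] //= _; rewrite /grid_adj /code /=; lia.
Qed.

End TilingGraphs.

Theorem theorem4 (R : realType) (G : sgraph (R * R)%type)
    (finG : finite_set (vertices G))
    (subG : subgraph G (square_grid R) \/
            subgraph G (hexagonal_grid R) \/
            subgraph G (octagonal_square_grid R)) :
  has_unit_cube_contact_rep R G.
Proof.
case: subG => [|[|]].
- exact: square_grid_contact_rep.
- exact: hexagonal_grid_contact_rep.
- exact: octagonal_square_grid_contact_rep.
Qed.
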